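(* Let $(X,f_{1,\infty})$ be a non-autonomous discrete dynamical system and let $\mathcal{F}$ be a Furstenberg family which is filterdual. Then $(X,f_{1,\infty})$ is weakly $\mathcal{F}$-sensitive if and only if it is $\mathcal{F}$-sensitive.
   Context: A non-autonomous discrete dynamical system $(X,f_{1,\infty})$ consists of a compact metric space $(X,d)$ and a sequence $f_{1,\infty}=(f_n)_{n\ge 1}$ of continuous maps $f_n:X\to X$. Write $f_1^n=f_n\circ\cdots\circ f_1$ for $n\geq 1$. Let $\mathbb{Z}^+=\mathbb{N}$ denote the positive integers and let $\mathcal{P}$ be the collection of all subsets of $\mathbb{Z}^+$. A Furstenberg family is a collection $\mathcal{F}\subseteq\mathcal{P}$ that is hereditary upwards: $F_1\subset F_2$ and $F_1\in\mathcal{F}$ imply $F_2\in\mathcal{F}$. All Furstenberg families are assumed proper, i.e. $\mathcal{F}\neq\emptyset$ and $\mathcal{F}\neq\mathcal{P}$. The dual family is $k\mathcal{F}=\{F\in\mathcal{P}: F\cap F'\neq\emptyset \text{ for all } F'\in\mathcal{F}\}=\{F\in\mathcal{P}:\mathbb{Z}^+\setminus F\notin\mathcal{F}\}$. For families $\mathcal{F}_1,\mathcal{F}_2$ put $\mathcal{F}_1\cdot\mathcal{F}_2=\{F_1\cap F_2: F_1\in\mathcal{F}_1,F_2\in\mathcal{F}_2\}$. A Furstenberg family $\mathcal{F}$ is filterdual if it is proper and $k\mathcal{F}\cdot k\mathcal{F}\subseteq k\mathcal{F}$. $(X,f_{1,\infty})$ is weakly $\mathcal{F}$-sensitive if there exists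 $\delta>0$ such that every non-empty open $U\subseteq X$ contains points $x,y$ with $\{n\in\mathbb{N}: d(f_1^n(x),f_1^n(y))>\delta\}\in\mathcal{F}$. $(X,f_{1,\infty})$ is $\mathcal{F}$-sensitive if there exists $\delta>0$ such that for every $x\in X$ and every open neighbourhood $U$ of $x$ there exists $y\in U$ such that $(x,y)$ is not $\mathcal{F}$-$\delta$-asymptotic, i.e. $\{n\in\mathbb{N}: d(f_1^n(x),f_1^n(y))>\delta\}\in\mathcal{F}$. *)

(* Defs.v *)
From mathcomp Require Import all_boot all_order all_algebra.
From mathcomp Require Import all_classical all_reals topology.

Set Implicit Arguments.
Unset Strict Implicit.
Unset Printing Implicit Defensive.

Import Order.TTheory GRing.Theory Num.Theory.
Local Open Scope classical_set_scope.
Local Open Scope ring_scope.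

(* The index set $\mathbb{Z}^+ = \{1, 2, \dots\}$. *)
Definition posnat : Type := {n : nat | (0 < n)%N}.

Definition posnatS (n : nat) : posnat := exist _ n.+1 (ltn0Sn n).

(* A collection of subsets of the positive integers is a
   [set (set posnat)]; [setT] is then the full power set. *)
Definition hereditary_upwards (F : set (set posnat)) : Prop :=
  forall A B : set posnat, A `<=` B -> F A -> F B.

Definition proper_family (F : set (set posnat)) : Prop :=
  F <> set0 /\ F <> [set: set posnat].

Definition furstenberg_family (F : set (set posnat)) : Prop :=
  hereditary_upwards F /\ proper_family F.

Definition dual_family (F : set (set posnat)) : set (set posnat) :=
  [set A | forall B, F B -> A `&` B !=set0].

Lemma dual_familyE (F : set (set posnat)) :
  hereditary_upwards F -> dual_family F = [set A | ~ F (~` A)].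
Proof.
move=> hF; apply/seteqP; split=> A /= hA.
  by move=> /hA; rewrite setICr => -[].
move=> B FB; apply: contrapT => /nonemptyPn AB0; apply: hA.
by apply: hF FB; rewrite -disjoints_subset setIC.
Qed.

Definition family_dot (F1 F2 : set (set posnat)) : set (set posnat) :=
  [set A `&` B | A in F1 & B in F2].

Definition filterdual (F : set (set posnat)) : Prop :=
  proper_family F /\
  family_dot (dual_family F) (dual_family F) `<=` dual_family F.

Section Sensitivity.
Variables (R : realType) (X : metricType R) (f : posnat -> X -> X).

Definition nds : Prop :=
  compact [set: X] /\ forall n : posnat, continuous (f n).

Fixpoint iterate_upto (n : nat) : X -> X :=
  if n is m.+1 then f (posnatS m) \o iterate_upto m else id.

(* $f_1^n = f_n \circ \dots \circ f_1$. *)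
Definition nds_iter (n : posnat) : X -> X := iterate_upto (val n).

Definition separation_times (delta : R) (x y : X) : set posnat :=
  [set n | delta < mdist (nds_iter n x) (nds_iter n y)].

Definition weakly_sensitive (F : set (set posnat)) : Prop :=
  exists2 delta : R, 0 < delta &
    forall U : set X, open U -> U !=set0 ->
      exists x y, [/\ U x, U y & F (separation_times delta x y)].

Definition sensitive (F : set (set posnat)) : Prop :=
  exists2 delta : R, 0 < delta &
    forall (x : X) (U : set X), open U -> U x ->
      exists2 y, U y & F (separation_times delta x y).

End Sensitivity.

(* Main.v *)
(* By duality, kF being closed under intersections means that F is partition
   regular: if A `|` B is in F, then so is A or B.  If y and z in U are more than
   delta apart at the times of a set of F, then at each such time one of them is
   more than delta / 2 away from x, so that one of the pairs (x, y), (x, z) is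
   delta / 2 separated along a set of F. *)
Require Import Defs.
From mathcomp Require Import all_boot all_order all_algebra.
From mathcomp Require Import all_classical all_reals topology.
From mathcomp Require Import lra.

Import Order.TTheory GRing.Theory Num.Theory.
Local Open Scope classical_set_scope.
Local Open Scope ring_scope.

Lemma filterdual_setU (F : set (set posnat)) (A B : set posnat) :
  hereditary_upwards F -> filterdual F -> F (A `|` B) -> F A \/ F B.
Proof.
move=> hF [_ dotF] FAB; apply: contrapT => /not_orP[nFA nFB].
have dualC C : ~ F C -> dual_family F (~` C).
  by rewrite (dual_familyE hF) /= setCK.
(* By De Morgan this is the complement of the union, so its lying in the dual keeps the union out of
   [F], against [FAB]. *)
have : dual_family F (~` A `&` ~` B).
  by apply: dotF; exists (~` A); [exact: dualC|exists (~` B) => //; exact: dualC].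
by rewrite (dual_familyE hF) /= -setCU setCK.
Qed.

Lemma separation_times_split (R : realType) (X : metricType R)
    (f : posnat -> X -> X) (delta : R) (x y z : X) :
  separation_times f delta y z `<=`
  separation_times f (delta / 2) x y `|` separation_times f (delta / 2) x z.
Proof.
move=> n; rewrite /separation_times /= => yz.
have tri := metric_triangle (nds_iter f n y) (nds_iter f n x) (nds_iter f n z).
rewrite (metric_sym (nds_iter f n y) (nds_iter f n x)) in tri.
(* If [x] and [y] are within [delta / 2] at time [n], [tri] forces [z] farther than [delta / 2] from
   [x]. *)
case: (ltP (delta / 2) (mdist (nds_iter f n x) (nds_iter f n y))) => xy.
  by left.
by right; lra.
Qed.

Theorem theorem3p1 (R : realType) (X : metricType R) (f : posnat -> X -> X)
    (F : set (set posnat)) :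
  nds f -> furstenberg_family F -> filterdual F ->
  (weakly_sensitive f F <-> sensitive f F).
Proof.
move=> _ [hF _] dF; split=> -[delta delta0 sens].
  exists (delta / 2) => [|x U oU Ux]; first by rewrite divr_gt0.
  have [|y [z [Uy Uz Fyz]]] := sens U oU; first by exists x.
  (* Heredity puts the larger union in [F] before it is split. *)
  have /(filterdual_setU _ _ _ hF dF)[Fxy|Fxz] :=
    hF _ _ (separation_times_split _ _ f delta x y z) Fyz.
    by exists y.
  by exists z.
(* Conversely, any point of [U] can start the pair, with the same [delta]. *)
exists delta => // U oU [x Ux]; have [y Uy Fxy] := sens x U oU Ux.
by exists x, y.
Qed.
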